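(* Let $\lambda>\sqrt{2+\sqrt5}$. The eigenvector $\xi$ of the graph $\Gamma_\lambda$ (for the eigenvalue $\lambda$) given by $$\xi(P_k)=a_k\ (k\ge0),\qquad \xi(Q_{k,j})=\frac{a_k}{\lambda}\ \ (1\le j\le n_k,\ \text{if } n_k\ne0)$$ is summable.
   Context: For $\lambda>\sqrt{2+\sqrt5}$ choose $x>0$ with $\lambda=e^x+e^{-x}$. Numbers $n_k,r_k,a_k$ are defined inductively by $n_0=0$, $r_1=\lambda$, $a_0=1$ and, for $k\ge1$, $$n_k=\max\Big\{j\in\mathbb Z:\lambda-\frac1{r_k}-\frac j\lambda\ge e^{-x}\Big\},\qquad r_{k+1}=\lambda-\frac1{r_k}-\frac{n_k}\lambda,\qquad a_k=r_ka_{k-1}.$$ The infinite graph $\Gamma_\lambda$ consists of the one-sided infinite path with vertices $P_0,P_1,P_2,\dots$ ($P_i$ joined to $P_{i+1}$) together with $n_k$ leaves $Q_{k,1},\dots,Q_{k,n_k}$ attached to $P_k$ for each $k$. Summable means that the sum of $\xi$ over all vertices is finite. *)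

(* Defs.v *)
From HB Require Import structures.
From mathcomp Require Import all_boot all_order all_algebra.
From mathcomp Require Import all_classical all_reals all_analysis.

Set Implicit Arguments.
Unset Strict Implicit.
Unset Printing Implicit Defensive.
Import Order.TTheory GRing.Theory Num.Theory.
Local Open Scope classical_set_scope.
Local Open Scope ring_scope.

(* The largest element of a set of integers; 0 if there is none. *)
Definition max_int (A : set int) : int := xget 0 (A `&` ubound A).

Section sequences.
Variables (R : realType) (lam x : R).

(* n_k as a function of the value r = r_k, for k >= 1. *)
Definition leaf_step (r : R) : int :=
  max_int [set j : int | lam - r^-1 - j%:~R / lam >= expR (- x)].

(* The sequence r_k starts at k = 1; the value at k = 0 is not used. *)
Fixpoint ratio (k : nat) : R :=
  match k with
  | 0%N => 0
  | k'.+1 =>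
      match k' with
      | 0%N => lam
      | _.+1 => lam - (ratio k')^-1 - (leaf_step (ratio k'))%:~R / lam
      end
  end.

Definition leaf_num (k : nat) : int :=
  if k is 0%N then 0 else leaf_step (ratio k).

Fixpoint spine (k : nat) : R :=
  if k is k'.+1 then ratio k * spine k' else 1.

End sequences.

(* Vertices of the half-line with n k leaves attached to its k-th vertex; the
   leaves at P k are numbered from 0. *)
Inductive vertex (n : nat -> nat) : Type :=
  | P of nat
  | Q (k : nat) of 'I_(n k).
Arguments P {n}.
Arguments Q {n}.

HB.instance Definition _ (n : nat -> nat) := gen_eqMixin (vertex n).
HB.instance Definition _ (n : nat -> nat) := gen_choiceMixin (vertex n).

Definition adj (n : nat -> nat) (u v : vertex n) : Prop :=
  match u, v with
  | P i, P j => j = i.+1 \/ i = j.+1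
  | P i, Q k _ => i = k
  | Q k _, P i => i = k
  | Q _ _, Q _ _ => False
  end.

(* Local finiteness is required explicitly because the finitely supported sum
   below is 0 when the support is infinite. *)
Definition eigenvector (R : realType) (V : choiceType) (e : V -> V -> Prop)
    (lam : R) (f : V -> R) : Prop :=
  (exists v, f v != 0) /\
  forall v, finite_set [set w | e v w] /\
            \sum_(w \in [set w | e v w]) f w = lam * f v.

Section Gamma.
Variables (R : realType) (lam x : R).

(* The numbers n_k are nonnegative in the range of parameters considered (see
   leaf_num_ge0), so the absolute value changes nothing. *)
Definition Gamma_vertex := vertex (fun k => `|leaf_num lam x k|%N).
HB.instance Definition _ := Choice.on Gamma_vertex.

Definition Gamma_adj : Gamma_vertex -> Gamma_vertex -> Prop := @adj _.

Definition xi (v : Gamma_vertex) : R :=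
  match v with
  | P k => spine lam x k
  | Q k _ => spine lam x k / lam
  end.

End Gamma.

Section leaf_num_facts.
Variables (R : realType) (lam x : R).
Hypothesis lam_def : lam = expR x + expR (- x).

Let lam_gt0 : 0 < lam.
Proof. by rewrite lam_def addr_gt0 ?expR_gt0. Qed.

Let stepP r (A := [set j : int | lam - r^-1 - j%:~R / lam >= expR (- x)]) :
  A (leaf_step lam x r) /\ ubound A (leaf_step lam x r).
Proof.
have AE j : A j <-> j <= Num.floor (lam * (lam - r^-1 - expR (- x))).
  rewrite /A /= floor_ge_int lerBrDr addrC -lerBrDr ler_pdivrMr//.
  by rewrite mulrC.
rewrite /leaf_step /max_int -/A; apply: (@xgetI _ 0 (A `&` ubound A) (Num.floor (lam * (lam - r^-1 - expR (- x))))).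
by split; [exact/AE|move=> j /AE].
Qed.

Lemma leaf_numP k (A := [set j : int |
    lam - (ratio lam x k)^-1 - j%:~R / lam >= expR (- x)]) : (0 < k)%N ->
  A (leaf_num lam x k) /\ ubound A (leaf_num lam x k).
Proof. by case: k @A => // k A _; exact: stepP. Qed.

Lemma ratio_ge k : (0 < k)%N -> expR (- x) <= ratio lam x k.
Proof.
case: k => // -[_|k _]; first by rewrite /= lam_def lerDr expR_ge0.
by have [] := @stepP (ratio lam x k.+1).
Qed.

Lemma leaf_num_ge0 k : 0 <= leaf_num lam x k.
Proof.
case: k => // k; have [_] := @leaf_numP k.+1 isT; apply => /=.
have r_ge := @ratio_ge k.+1 isT.
have r_gt0 := lt_le_trans (expR_gt0 (- x)) r_ge.
rewrite mul0r subr0 {1}lam_def addrAC lerDr subr_ge0.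
have -> : expR x = (expR (- x))^-1 by rewrite expRN invrK.
by rewrite lef_pV2 ?posrE ?expR_gt0.
Qed.

End leaf_num_facts.

(* Main.v *)
Require Import Defs.
From HB Require Import structures.
From mathcomp Require Import all_boot all_order all_algebra.
From mathcomp Require Import all_classical all_reals all_analysis.
From mathcomp Require Import ring lra.

Import Order.TTheory GRing.Theory Num.Theory.
Local Open Scope classical_set_scope.
Local Open Scope ring_scope.

(* The sequence r_k, as opposed to formal fractions. *)
Local Notation ratio := Defs.ratio.

(** Write q = e^(-x), so that lam = 1/q + q, and c_k = n_k / lam.  The spine
satisfies a_(k-1) + a_(k+1) + c_k a_k = lam a_k ([spine_rec]), which is the
eigenvector equation, and maximality of n_k gives q <= r_k < q + 1/lam for
k >= 2.  The hypothesis on lam amounts to q^2 + q^4 < 1 ([golden_bound]), that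
is, to q + 1/lam < 1/q, so r_k stays away from 1/q.

Where n_k = 0 the recurrence has the solutions q^k and q^(-k), and the product
of the two corresponding coordinates
  E_k = (a_k - q a_(k-1)) (a_(k-1)/q - a_k)
is conserved.  In general
  E_k - E_(k+1) = a_k^2 c_k (2/r_k - 1/q - q + c_k),
and if n_k >= 1 the last factor is at least
2/(q + 1/lam) - 1/q - q + 1/lam, which is positive precisely because
q^2 + q^4 < 1 ([drop_rate_gt0]).  Since E_k is also at most (a_k/q)^2, the
square root of E_k drops by at least a constant times c_k a_k for every k >= 2
([sqrt_energy_drop]); hence the sum of the c_k a_k, the mass of the leaves, is
finite.

It remains to control the spine.  The coordinate U_k = a_k/q - a_(k+1) is at
least a constant times a_k and satisfies U_k = q U_(k-1) + c_k a_k with q < 1.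
So, for a suitable B, the potential U_(k-1) + B sqrt E_k decreases at each step
by at least a constant times a_k + c_k a_k, the total mass of P_k and its
leaves ([mass_le_potential]); telescoping bounds the sum over all vertices. *)

(** * Elementary inequalities *)

(** Both conditions say that q^2 is smaller than (sqrt 5 - 1) / 2, the positive
root of t^2 + t = 1. *)
Lemma golden_bound {R : realType} (lam q : R) : 0 < q -> q < 1 ->
  lam = q^-1 + q -> Num.sqrt (2 + Num.sqrt 5) < lam -> q ^+ 2 + q ^+ 4 < 1.
Proof.
move=> q0 q1 lamE lam_gt.
set s : R := Num.sqrt 5 in lam_gt *.
have s0 : 0 <= s by exact: sqrtr_ge0.
have s2 : s ^+ 2 = 5 by rewrite sqr_sqrtr.
have lam2 : 2 + s < lam ^+ 2.
  rewrite -[ltLHS]sqr_sqrtr; last by rewrite addr_ge0.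
  have l0 : 0 <= Num.sqrt (2 + s) by exact: sqrtr_ge0.
  by rewrite ltr_pXn2r// nnegrE// (le_trans l0)// ltW.
have q0' : q != 0 by rewrite gt_eqF.
have qt : 0 < q ^+ 4 - s * q ^+ 2 + 1.
  have -> : q ^+ 4 - s * q ^+ 2 + 1 = q ^+ 2 * (lam ^+ 2 - (2 + s)).
    by rewrite lamE; field.
  by rewrite mulr_gt0 ?exprn_gt0// subr_gt0.
have t0 : 0 < q ^+ 2 by rewrite exprn_gt0.
have t1 : q ^+ 2 < 1 by rewrite exprn_ilt1// ltW.
have tE : q ^+ 4 = q ^+ 2 * q ^+ 2 by rewrite -exprD.
rewrite tE in qt *.
set t := q ^+ 2 in qt t0 t1 *.
have s_gt1 : 1 < s by rewrite expr2 in s2; nra.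
have t_lt : t < (s - 1) / 2.
  rewrite ltNge; apply/negP => ht.
  have ? : t < (s + 1) / 2 by lra.
  have : (t - (s - 1) / 2) * (t - (s + 1) / 2) <= 0 by rewrite mulr_ge0_le0//; lra.
  have -> : (t - (s - 1) / 2) * (t - (s + 1) / 2) =
            t * t - s * t + (s ^+ 2 - 1) / 4 by field.
  rewrite s2; lra.
rewrite expr2 in s2; nra.
Qed.

(** As sqrt A - sqrt B = (A - B) / (sqrt A + sqrt B) and both roots are at
most M. *)
Lemma sqrt_drop {R : realType} (A B M d : R) : 0 < M -> 0 <= B -> B <= A ->
  A <= M ^+ 2 -> 2 * M * d <= A - B -> d <= Num.sqrt A - Num.sqrt B.
Proof.
move=> M0 B0 BA AM drop.
have sBA : Num.sqrt B <= Num.sqrt A by rewrite ler_wsqrtr.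
have sAM : Num.sqrt A <= M.
  by rewrite (le_trans (ler_wsqrtr AM))// sqrtr_sqr ger0_norm// ltW.
have A0 := le_trans B0 BA.
have := sqr_sqrtr B0; have := sqr_sqrtr A0.
set u := Num.sqrt A in sBA sAM *; set v := Num.sqrt B in sBA *.
move=> AE BE; rewrite -AE -BE in drop.
rewrite -(ler_pM2l (_ : 0 < 2 * M)) ?mulr_gt0//.
apply: (le_trans drop); rewrite subr_sqr mulrC ler_wpM2r ?subr_ge0//.
lra.
Qed.

(** * The conserved quadratic form *)

(** The form E for two consecutive spine values p and r * p, that is
(r p - q p) (p / q - r p). *)
Definition energy {R : realType} (q p r : R) : R :=
  p ^+ 2 * ((r - q) * (q^-1 - r)).

Lemma energy_ge0 {R : realType} (q p r : R) :
  q <= r -> r <= q^-1 -> 0 <= energy q p r.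
Proof.
by move=> qr rq; rewrite mulr_ge0 ?sqr_ge0// mulr_ge0// subr_ge0.
Qed.

Lemma energy_le {R : realType} (q p r : R) : 0 < q -> q <= r -> r <= q^-1 ->
  energy q p r <= (r * p / q) ^+ 2.
Proof.
move=> q0 qr rq; have r0 := lt_le_trans q0 qr.
have -> : (r * p / q) ^+ 2 = p ^+ 2 * (r * (r / q / q)).
  by field; rewrite gt_eqF.
rewrite ler_wpM2l ?sqr_ge0// ler_pM ?subr_ge0//.
  by rewrite gerBl ltW.
rewrite (@le_trans _ _ q^-1) ?gerBl ?(ltW r0)//.
by rewrite ler_peMl ?invr_ge0 ?(ltW q0)// ler_pdivlMr// mul1r.
Qed.

(** One step of the recurrence, from the ratio r to lam - 1/r - c; for c = 0
the energy is conserved. *)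
Lemma energy_step {R : realType} (q lam p r c : R) : q != 0 -> r != 0 ->
  lam = q^-1 + q ->
  energy q p r - energy q (r * p) (lam - r^-1 - c) =
  (r * p) ^+ 2 * (c * (2 / r - q^-1 - q + c)).
Proof. by move=> q0 r0 ->; rewrite /energy; field; rewrite q0 r0. Qed.

(** A lower bound for 2/r - 1/q - q + n/lam when
0 < r <= q + 1/lam and n >= 1. *)
Definition drop_rate {R : realType} (q lam : R) : R :=
  2 / (q + lam^-1) - q^-1 - q + lam^-1.

Lemma drop_rate_gt0 {R : realType} (q lam : R) : 0 < q ->
  lam = q^-1 + q -> q ^+ 2 + q ^+ 4 < 1 -> 0 < drop_rate q lam.
Proof.
move=> q0 lamE hq.
have p2 : 0 < q ^+ 2 by rewrite exprn_gt0.
have -> : drop_rate q lam =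
    q * (1 - q ^+ 2 - q ^+ 4) / ((2 + q ^+ 2) * (1 + q ^+ 2)).
  rewrite /drop_rate lamE; field.
  by rewrite ?gt_eqF//; nra.
rewrite divr_gt0 ?mulr_gt0//; lra.
Qed.

Lemma upper_bound_lt {R : realType} (q lam : R) : 0 < q ->
  lam = q^-1 + q -> q ^+ 2 + q ^+ 4 < 1 -> q + lam^-1 < q^-1.
Proof.
move=> q0 lamE hq; rewrite -subr_gt0.
have p2 : 0 < q ^+ 2 by rewrite exprn_gt0.
have -> : q^-1 - (q + lam^-1) = (1 - q ^+ 2 - q ^+ 4) / (q * (1 + q ^+ 2)).
  rewrite lamE; field.
  by rewrite ?gt_eqF//; nra.
rewrite divr_gt0 ?mulr_gt0//; lra.
Qed.

(** The inequality holds trivially for n = 0, where both sides vanish; for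
n >= 1 the loss of energy is quadratic in r * p and linear in c, and the energy
is bounded by the square of r * p / q. *)
Lemma sqrt_energy_drop {R : realType} (q lam p r : R) (n : int)
    (c := n%:~R / lam) : 0 < q -> lam = q^-1 + q -> q ^+ 2 + q ^+ 4 < 1 ->
  0 < p -> q <= r -> r <= q + lam^-1 -> 0 <= n ->
  q <= lam - r^-1 - c -> lam - r^-1 - c <= q^-1 ->
  drop_rate q lam * q / 2 * (c * (r * p)) <=
  Num.sqrt (energy q p r) - Num.sqrt (energy q (r * p) (lam - r^-1 - c)).
Proof.
move=> q0 lamE hq p0 qr rle n0 qr' r'q.
have r0 := lt_le_trans q0 qr.
have lam0 : 0 < lam by rewrite lamE addr_gt0 ?invr_gt0.
have rq : r <= q^-1 by rewrite (le_trans rle)// ltW// upper_bound_lt.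
have e0 := drop_rate_gt0 q lam q0 lamE hq.
have c0 : 0 <= c by rewrite divr_ge0 ?ler0z ?(ltW lam0).
have a0 : 0 < r * p by rewrite mulr_gt0.
have drop : c * drop_rate q lam <= c * (2 / r - q^-1 - q + c).
  have [n1|] := ltP 0 n; last first.
    move=> nle; have nE : n = 0 by apply/eqP; rewrite eq_le nle n0.
    by rewrite /c nE !mul0r.
  rewrite ler_wpM2l// /drop_rate lerD// ?lerD2r.
    by rewrite ler_pM2l// lef_pV2 ?posrE// addr_gt0 ?invr_gt0.
  by rewrite /c ler_peMl ?invr_ge0 ?(ltW lam0)// ler1z.
have key := energy_step q lam p r c (lt0r_neq0 q0) (lt0r_neq0 r0) lamE.
apply: (@sqrt_drop _ _ _ (r * p / q)).
- by rewrite divr_gt0.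
- exact: energy_ge0.
- rewrite -subr_ge0 key mulr_ge0 ?sqr_ge0// (le_trans _ drop)//.
  by rewrite mulr_ge0// ltW.
- exact: energy_le.
rewrite key.
have -> : 2 * (r * p / q) * (drop_rate q lam * q / 2 * (c * (r * p))) =
   (r * p) ^+ 2 * (c * drop_rate q lam) by field; rewrite gt_eqF.
by rewrite ler_wpM2l ?sqr_ge0.
Qed.

(** * The sequences along the half-line *)

Lemma ratioSS {R : realType} (lam x : R) k : ratio lam x k.+2 =
  lam - (ratio lam x k.+1)^-1 - (leaf_num lam x k.+1)%:~R / lam.
Proof. by []. Qed.

Lemma spineS {R : realType} (lam x : R) k :
  spine lam x k.+1 = ratio lam x k.+1 * spine lam x k.
Proof. by []. Qed.

Lemma ratio_gt0 {R : realType} (lam x : R) k : lam = expR x + expR (- x) ->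
  0 < ratio lam x k.+1.
Proof.
by move=> lamE; rewrite (lt_le_trans (expR_gt0 (- x)))// ratio_ge.
Qed.

Lemma spine_gt0 {R : realType} (lam x : R) k : lam = expR x + expR (- x) ->
  0 < spine lam x k.
Proof.
by move=> lamE; elim: k => [|k ih]; rewrite ?spineS ?mulr_gt0// ratio_gt0.
Qed.

(** Otherwise one more leaf could be attached. *)
Lemma ratio_lt {R : realType} (lam x : R) k : lam = expR x + expR (- x) ->
  ratio lam x k.+2 < expR (- x) + lam^-1.
Proof.
move=> lamE; rewrite ltNge; apply/negP => h.
have [_ /(_ (leaf_num lam x k.+1 + 1))] := @leaf_numP _ lam x lamE k.+1 isT.
rewrite /= -/(ratio lam x k.+1) -/(leaf_num lam x k.+1).
have -> : (leaf_num lam x k.+1 + 1 <= leaf_num lam x k.+1) = false.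
  by apply/negbTE; rewrite -ltNge ltrDl.
apply/not_implyP; split=> //.
rewrite intrD mulrDl mul1r opprD addrA lerBrDr.
by rewrite -(ratioSS lam x k).
Qed.

Lemma spine_rec {R : realType} (lam x : R) k : lam = expR x + expR (- x) ->
  spine lam x k + spine lam x k.+2 +
    (leaf_num lam x k.+1)%:~R * (spine lam x k.+1 / lam) =
  lam * spine lam x k.+1.
Proof.
move=> lamE; have r0 := ratio_gt0 lam x k lamE.
have lam0 : 0 < lam by rewrite lamE addr_gt0 ?expR_gt0.
rewrite (spineS lam x k.+1) ratioSS (spineS lam x k).
field; by rewrite !gt_eqF.
Qed.

(** The sum of the eigenvector over P k and its leaves. *)
Definition mass {R : realType} (lam x : R) (k : nat) : R :=
  spine lam x k + (leaf_num lam x k)%:~R * (spine lam x k / lam).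

Lemma mass_ge0 {R : realType} (lam x : R) k : lam = expR x + expR (- x) ->
  0 <= mass lam x k.
Proof.
move=> lamE; have a0 := spine_gt0 lam x k lamE.
have lam0 : 0 < lam by rewrite lamE addr_gt0 ?expR_gt0.
by rewrite addr_ge0 ?mulr_ge0 ?invr_ge0 ?ler0z ?leaf_num_ge0 ?ltW.
Qed.

(** The decreasing quantity U_k + B sqrt E_(k+1), where U_k = a_k/q - a_(k+1)
and q = e^(-x). *)
Definition potential {R : realType} (lam x B : R) (k : nat) : R :=
  spine lam x k * (expR (- x))^-1 - spine lam x k.+1 +
  B * Num.sqrt (energy (expR (- x)) (spine lam x k) (ratio lam x k.+1)).

(** The index starts at 1 because r_1 = lam exceeds 1/q: the bounds on r_k used
here hold for k >= 2 only. *)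
Lemma mass_le_potential {R : realType} (lam x : R) :
    Num.sqrt (2 + Num.sqrt 5) < lam -> 0 < x -> lam = expR x + expR (- x) ->
  exists B eta : R, 0 < eta /\ forall k : nat, 0 <= potential lam x B k.+1 /\
    eta * mass lam x k.+2 <=
    potential lam x B k.+1 - potential lam x B k.+2.
Proof.
move=> lam_gt x0 lamx.
set q := expR (- x).
have q0 : 0 < q by exact: expR_gt0.
have q1 : q < 1 by rewrite /q expRN invf_lt1 ?expR_gt0// expR_gt1.
have lamE : lam = q^-1 + q by rewrite lamx /q expRN invrK.
have hq := golden_bound lam q q0 q1 lamE lam_gt.
have e0 := drop_rate_gt0 q lam q0 lamE hq.
have ule := upper_bound_lt q lam q0 lamE hq.
set eps := drop_rate q lam in e0.
set dl := q^-1 - (q + lam^-1).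
have dl0 : 0 < dl by rewrite subr_gt0.
have lam0 : 0 < lam by rewrite lamE addr_gt0 ?invr_gt0.
(* B is chosen so that B (sqrt E_k - sqrt E_(k+1)) >= 2 c_k a_k: one half
   compensates the growth of U, the other bounds the mass of the leaves. *)
pose B := 4 / (eps * q).
have B0 : 0 < B by rewrite divr_gt0 ?mulr_gt0.
pose eta := Num.min 1 (q * (1 - q) * dl).
have eta0 : 0 < eta by rewrite lt_min ltr01 !mulr_gt0// subr_gt0.
exists B, eta; split=> // k.
have rB j : q <= ratio lam x j.+2 /\ ratio lam x j.+2 < q + lam^-1.
  by split; [exact: ratio_ge|exact: ratio_lt].
have rq j : ratio lam x j.+2 <= q^-1.
  by rewrite (le_trans _ (ltW ule))// ltW//; case: (rB j).
have a0 j : 0 < spine lam x j by exact: spine_gt0.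
split.
  rewrite /potential -/q addr_ge0//; last by rewrite mulr_ge0 ?sqrtr_ge0 ?ltW.
  by rewrite subr_ge0 spineS mulrC ler_wpM2l ?(ltW (a0 _))// rq.
have [qr /ltW rle] := rB k.
have n0 := @leaf_num_ge0 _ lam x lamx k.+2.
have r'B := rB k.+1; have r'q := rq k.+1.
have := sqrt_energy_drop q lam (spine lam x k.+1) (ratio lam x k.+2)
  (leaf_num lam x k.+2) q0 lamE hq (a0 _) qr rle n0.
rewrite -(ratioSS lam x k.+1) -spineS => /(_ (proj1 r'B) r'q).
have rec := spine_rec lam x k.+1 lamx.
have a1 := a0 k.+1; have a2 := a0 k.+2.
have a2E := spineS lam x k.+1.
rewrite /potential /mass -/q -/eps.
set s1 := Num.sqrt _; set s2 := Num.sqrt _.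
set b := _ / lam * _ => drop.
set n := (leaf_num lam x k.+2)%:~R in rec b drop *.
have bE : n * (spine lam x k.+2 / lam) = b by rewrite /b mulrA mulrAC.
rewrite bE in rec *.
have b0 : 0 <= b by rewrite mulr_ge0 ?divr_ge0 ?ler0z ?(ltW lam0) ?(ltW a2).
have drop2 : 2 * b <= B * (s1 - s2).
  have -> : 2 * b = B * (eps * q / 2 * b).
    by rewrite /B; field; rewrite !gt_eqF.
  by rewrite ler_wpM2l ?(ltW B0).
have d1 : dl * spine lam x k.+1 <= spine lam x k.+1 / q - spine lam x k.+2.
  rewrite a2E [_ / q]mulrC -mulrBl ler_wpM2r ?(ltW a1)//.
  by rewrite lerB.
have d2 : q * spine lam x k.+2 <= spine lam x k.+1.
  rewrite a2E mulrA ler_piMl ?(ltW a1)//.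
  by rewrite mulrC -ler_pdivlMr// mul1r rq.
(* With j = k + 2, this is U_j = q U_(j-1) + c_j a_j. *)
have U : spine lam x k.+2 / q - spine lam x k.+3 =
         q * (spine lam x k.+1 / q - spine lam x k.+2) + b.
  have -> : spine lam x k.+3 = lam * spine lam x k.+2 - spine lam x k.+1 - b.
    by rewrite -rec; ring.
  by rewrite lamE; field; rewrite gt_eqF.
rewrite U.
have l1 : eta * b <= b by rewrite ler_piMl// ge_min lexx.
have l2 : eta * spine lam x k.+2 <=
    (1 - q) * (spine lam x k.+1 / q - spine lam x k.+2).
  apply: (@le_trans _ _ ((q * (1 - q) * dl) * spine lam x k.+2)).
    by rewrite ler_wpM2r ?(ltW a2)// ge_min lexx orbT.
  have -> : q * (1 - q) * dl * spine lam x k.+2 =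
            (1 - q) * (dl * (q * spine lam x k.+2)) by ring.
  rewrite ler_wpM2l ?subr_ge0 ?(ltW q1)// (le_trans _ d1)//.
  by rewrite ler_wpM2l// ltW.
lra.
Qed.

Lemma sum_mass_le {R : realType} (lam x : R) :
    Num.sqrt (2 + Num.sqrt 5) < lam -> 0 < x -> lam = expR x + expR (- x) ->
  exists M : R, forall N : nat, \sum_(0 <= k < N) mass lam x k <= M.
Proof.
move=> lam_gt x0 lamx.
have [B [eta [eta0 H]]] := mass_le_potential lam x lam_gt x0 lamx.
exists (mass lam x 0 + mass lam x 1 + potential lam x B 1 / eta) => N.
have tele n : \sum_(0 <= k < n) mass lam x k.+2 <= 
    (potential lam x B 1 - potential lam x B n.+1) / eta.
  elim: n => [|n ih]; first by rewrite big_nil subrr mul0r.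
  rewrite big_nat_recr//= (le_trans (lerD ih (lexx _)))//.
  have [_ h] := H n.
  rewrite -lerBrDl -mulrBl ler_pdivlMr// mulrC (le_trans h)//.
  lra.
have m0 k : 0 <= mass lam x k by exact: mass_ge0.
apply: (@le_trans _ _ (\sum_(0 <= k < N.+2) mass lam x k)).
  by rewrite !big_nat_recr//= -addrA lerDl addr_ge0.
rewrite big_nat_recl// big_nat_recl// addrA lerD2l (le_trans (tele N))//.
by rewrite ler_pM2r ?invr_gt0// gerBl; case: (H N).
Qed.

(** * The vertices of the graph *)

(** The leaves attached to P k. *)
Definition leaves {R : realType} (lam x : R) (k : nat) :
    seq (Gamma_vertex lam x) :=
  [seq Q k j | j <- enum 'I_(`|leaf_num lam x k|%N)].

(** P k and its leaves. *)
Definition fibre {R : realType} (lam x : R) (k : nat) :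
    seq (Gamma_vertex lam x) := P k :: leaves lam x k.

Lemma uniq_leaves {R : realType} (lam x : R) (k : nat) :
  uniq (leaves lam x k).
Proof.
rewrite map_inj_uniq ?enum_uniq// => i j.
by move=> /(congr1 (fun v => if v is Q _ l then val l else 0%N))/val_inj.
Qed.

Lemma leavesP {R : realType} (lam x : R) (k : nat) (v : Gamma_vertex lam x) :
  reflect (exists j, v = Q k j) (v \in leaves lam x k).
Proof.
apply: (iffP mapP) => [[j _ ->]|[j ->]]; exists j => //.
by rewrite mem_enum.
Qed.

Lemma sum_leaves {R : realType} (lam x : R) (k : nat) :
    lam = expR x + expR (- x) ->
  \sum_(v <- leaves lam x k) xi v =
  (leaf_num lam x k)%:~R * (spine lam x k / lam).
Proof.
move=> lamx; rewrite big_map big_enum/= sumr_const card_ord -mulr_natl.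
by rewrite natr_absz ger0_norm ?leaf_num_ge0.
Qed.

Lemma sum_fibre {R : realType} (lam x : R) (k : nat) :
    lam = expR x + expR (- x) ->
  \sum_(v <- fibre lam x k) xi v = mass lam x k.
Proof. by move=> lamx; rewrite big_cons sum_leaves. Qed.

Lemma uniq_fibre {R : realType} (lam x : R) (k : nat) : uniq (fibre lam x k).
Proof. by apply/andP; split; [apply/leavesP => -[]|exact: uniq_leaves]. Qed.

(** The k for which v is P k or one of its leaves. *)
Definition level {R : realType} {lam x : R} (v : Gamma_vertex lam x) : nat :=
  match v with P k => k | Q k _ => k end.

Lemma mem_fibre {R : realType} (lam x : R) (k : nat) (v : Gamma_vertex lam x) :
  (v \in fibre lam x k) = (level v == k).
Proof.
apply/idP/eqP => [|<-].
  by rewrite inE => /orP[/eqP->//|/leavesP[j ->]].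
case: v => [i|i j] /=; first exact: mem_head.
by rewrite inE; apply/orP; right; apply/leavesP; exists j.
Qed.

Lemma xi_ge0 {R : realType} (lam x : R) (v : Gamma_vertex lam x) :
  lam = expR x + expR (- x) -> 0 <= xi v.
Proof.
move=> lamx; have lam0 : 0 < lam by rewrite lamx addr_gt0 ?expR_gt0.
by case: v => [k|k j] /=; rewrite ?divr_ge0 ?(ltW lam0)// ltW// spine_gt0.
Qed.

Lemma summable_xi {R : realType} (lam x : R) :
    Num.sqrt (2 + Num.sqrt 5) < lam -> 0 < x -> lam = expR x + expR (- x) ->
  summable [set: Gamma_vertex lam x] (fun v => (xi v)%:E).
Proof.
move=> lam_gt x0 lamx.
have [M sumM] := sum_mass_le lam x lam_gt x0 lamx.
have xi0 (v : Gamma_vertex lam x) : (0 <= (xi v)%:E)%E by rewrite lee_fin xi_ge0.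
rewrite /summable (eq_esum (b := fun v => (xi v)%:E)); last first.
  by move=> v _; rewrite gee0_abs.
have -> : [set: Gamma_vertex lam x] = \bigcup_k [set` fibre lam x k].
  apply/seteqP; split=> // v _; exists (level v) => //=.
  by rewrite mem_fibre.
rewrite nneseries_sum_bigcup//; last first.
  apply/trivIsetP => i j _ _ ij; apply/seteqP; split=> // v [] /=.
  by rewrite !mem_fibre => /eqP-> /eqP e; rewrite e eqxx in ij.
rewrite (eq_eseriesr (g := fun k => (mass lam x k)%:E)); last first.
  move=> k _; rewrite esum_fset; [|exact: finite_seq|by []].
  by rewrite -(fsbig_seq _ _ (uniq_fibre lam x k)) sumEFin sum_fibre.
apply: (@le_lt_trans _ _ M%:E); last exact: ltry.
apply: lime_le; first by apply: is_cvg_nneseries => k _ _; rewrite lee_fin mass_ge0.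
by apply: nearW => N; rewrite sumEFin lee_fin.
Qed.

Lemma neighbours_sum {R : realType} {V : choiceType} (e : V -> V -> Prop)
    (f : V -> R) (v : V) (s : seq V) : uniq s -> (forall w, e v w <-> w \in s) ->
  finite_set [set w | e v w] /\
  \sum_(w \in [set w | e v w]) f w = \sum_(w <- s) f w.
Proof.
move=> us es; have -> : [set w | e v w] = [set` s].
  by apply/seteqP; split=> w /es.
by rewrite -fsbig_seq.
Qed.

Lemma eigenvector_xi {R : realType} (lam x : R) :
    lam = expR x + expR (- x) ->
  eigenvector (@Gamma_adj R lam x) lam (@xi R lam x).
Proof.
move=> lamx; have lam0 : 0 < lam by rewrite lamx addr_gt0 ?expR_gt0.
split; first by exists (P 0); rewrite /= oner_neq0.
case=> [[|k]|k j].
- have [|w|fin ->] := @neighbours_sum R _ (@Gamma_adj R lam x) (@xi R lam x) (P 0) [:: P 1].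
  + by [].
  + rewrite inE; split=> [|/eqP->]; last by left.
    by case: w => [i [->|]|i j /= i0] //; move: j; rewrite -i0 => -[].
  + by rewrite big_seq1 /= mulr1.
- have [||fin ->] := @neighbours_sum R _ (@Gamma_adj R lam x) (@xi R lam x) (P k.+1)
      [:: P k, P k.+2 & leaves lam x k.+1].
  + apply/and3P; split; last exact: uniq_leaves.
    * rewrite inE negb_or; apply/andP; split; last by apply/leavesP => -[].
      by apply/eqP => -[] /eqP; rewrite ltn_eqF.
    * by apply/leavesP => -[].
  + move=> w; rewrite 2!inE; split.
    * case: w => [i|i j] /=.
        by case=> [->|[->]]; rewrite eqxx ?orbT.
      move=> e; subst i; apply/orP; right; apply/orP; right.
      by apply/leavesP; exists j.
    * by move=> /or3P[/eqP->|/eqP->|/leavesP[j ->]] //=; [right|left].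
  + by rewrite 2!big_cons sum_leaves// addrA spine_rec.
- have [|w|fin ->] := @neighbours_sum R _ (@Gamma_adj R lam x) (@xi R lam x) (Q k j) [:: P k].
  + by [].
  + rewrite inE; split=> [|/eqP->//].
    by case: w => [i /= ->|].
  + by rewrite big_seq1 /= mulrCA divff ?mulr1// gt_eqF.
Qed.

Theorem proposition19p7 (R : realType) (lam x : R)
    (lam_gt : Num.sqrt (2 + Num.sqrt 5) < lam)
    (x_gt0 : 0 < x)
    (lam_def : lam = expR x + expR (- x)) :
  eigenvector (@Gamma_adj R lam x) lam (@xi R lam x) /\
  summable [set: Gamma_vertex lam x] (fun v => (xi v)%:E).
Proof.
split; first exact: eigenvector_xi.
exact: summable_xi.
Qed.
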